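(* Let $k\ge 1$, $n\ge 1$, $r_1,\dots,r_{k-1}\ge 0$ with $r_1+\cdots+r_{k-1}\le n$, and let $W=W_1\cdots W_n$ with $W_m\in\{d,a_1,\dots,a_{k-1},e\}$ be a state in $\Omega^n_{r_1,\dots,r_{k-1}}$ of the $k$-species PASEP with parameters $\alpha$, $\beta$, $q_{0\infty}$, $q_{0i}$, $q_{i\infty}$ ($1\le i\le k-1$) and $q_{ij}$ ($1\le j<i\le k-1$). Suppose there are matrices $D,A_1,\dots,A_{k-1},E$, a row vector $\langle w|$ and a column vector $|v\rangle$ with $\langle w|\,|v\rangle=1$ such that $$DE-q_{0\infty}ED=D+E,\qquad DA_i-q_{0i}A_iD=A_i,\qquad A_iE-q_{i\infty}EA_i=A_i\qquad(1\le i\le k-1),$$ $$A_iA_j-q_{ij}A_jA_i=0\qquad(1\le j<i\le k-1),$$ $$\langle w|E=\frac1\alpha\langle w|,\qquad D|v\rangle=\frac1\beta|v\rangle .$$ Let $Z_{n,r_1,\dots,r_{k-1}}$ be the coefficient of $y_1^{r_1}\cdots y_{k-1}^{r_{k-1}}$ in $$\frac{\langle w|(D+y_1A_1+\cdots+y_{k-1}A_{k-1}+E)^n|v\rangle}{\langle w|A_{k-1}^{r_{k-1}}\cdots A_1^{r_1}|v\rangle},$$ where $\langle w|A_{k-1}^{r_{k-1}}\cdots A_1^{r_1}|v\rangle\neq 0$ and $Z_{n,r_1,\dots,r_{k-1}}\ne 0$. Then the stationary probability of the state $W$ (for the process restricted to $\Omega^n_{r_1,\dots,r_{k-1}}$)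 is $$\mathrm{Prob}(W)=\frac{1}{Z_{n,r_1,\dots,r_{k-1}}}\cdot\frac{\langle w|\,M_{W_1}M_{W_2}\cdots M_{W_n}\,|v\rangle}{\langle w|A_{k-1}^{r_{k-1}}\cdots A_1^{r_1}|v\rangle},$$ where $M_d=D$, $M_e=E$ and $M_{a_i}=A_i$.
   Context: $\Omega^n_{r_1,\dots,r_{k-1}}$ is the set of words of length $n$ in the letters $\{d,a_1,\dots,a_{k-1},e\}$ containing exactly $r_i$ letters $a_i$ for each $1\le i\le k-1$. The $k$-species PASEP is the Markov chain on $\Omega^n_{r_1,\dots,r_{k-1}}$ with the following transitions, where $X,Y$ denote arbitrary words and ''$U\to V$ at rate $u$'' means that the transition from $U$ to $V$ has probability $u/(n+1)$ (with the remaining probability the chain stays in place): - $XdeY\to XedY$ at rate $1$, and $XedY\to XdeY$ at rate $q_{0\infty}$; - for $1\le i\le k-1$: $Xda_iY\to Xa_idY$ at rate $1$, and $Xa_idY\to Xda_iY$ at rate $q_{0i}$; - for $1\le i\le k-1$: $Xa_ieY\to Xea_iY$ at rate $1$, and $Xea_iY\to Xa_ieY$ at rate $q_{i\infty}$; - for $1\le j<i\le k-1$: $Xa_ia_jY\to Xa_ja_iY$ at rate $1$, and $Xa_ja_iY\to Xa_ia_jY$ at rate $q_{ij}$; - $eX\to dX$ at rate $\alpha$ and $Xd\to Xe$ at rate $\beta$. Here $\alpha,\beta>0$ are such that the transition probabilities out of each state sum to at most $1$, and all the parameters $q_{\ast}$ lie in $[0,1]$. The matrices and vectors may be infinite; all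 products occurring are assumed to be well defined and associative. *)

(* Defs.v *)
From HB Require Import structures.
From mathcomp Require Import all_boot all_order all_algebra.
From mathcomp Require Import all_classical topology normedtype sequences.
From mathcomp Require Import(canonicals, coercions) mpoly.

Set Implicit Arguments.
Unset Strict Implicit.
Unset Printing Implicit Defensive.

Import Order.TTheory GRing.Theory Num.Theory.
Import numFieldNormedType.Exports.

Local Open Scope ring_scope.

(* The scalars form an arbitrary [K : numFieldType], which covers both real
   and complex matrices.  In such a K, [0 <= x] entails that x is real. *)

(* Rows and columns are indexed by nat; a finite matrix is a matrix padded with
   zeros.  Row vectors are [one] x [inf], column vectors are [inf] x [one]. *)
Variant dim := one | inf.

Definition idx (s : dim) : Type := if s is inf then nat else unit.

Definition mat (K : Type) (s t : dim) : Type := idx s -> idx t -> K.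

Definition rowvec (K : Type) := mat K one inf.
Definition colvec (K : Type) := mat K inf one.

Definition scalar_of (K : Type) (x : mat K one one) : K := x tt tt.

Definition mulm_defined (K : numFieldType) (s t : dim)
    (X : mat K s inf) (Y : mat K inf t) : Prop :=
  forall i j, cvgn (series (fun l : nat => X i l * Y l j)).

Definition mulm (K : numFieldType) (s t : dim)
    (X : mat K s inf) (Y : mat K inf t) : mat K s t :=
  fun i j => limn (series (fun l : nat => X i l * Y l j)).

(* The paper's a_1, ..., a_{k-1} are [la i] with i : 'I_k.-1 starting at 0. *)
Variant letter (k : nat) := ld | la of 'I_k.-1 | le.
Arguments ld {k}.
Arguments la {k} i.
Arguments le {k}.

Definition letter_code k (x : letter k) : option (option 'I_k.-1) :=
  match x with ld => None | la i => Some (Some i) | le => Some None end.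

Definition letter_decode k (x : option (option 'I_k.-1)) : letter k :=
  match x with None => ld | Some (Some i) => la i | Some None => le end.

Lemma letter_codeK k : cancel (@letter_code k) (@letter_decode k).
Proof. by case. Qed.

HB.instance Definition _ k :=
  Countable.copy (letter k) (can_type (@letter_codeK k)).
HB.instance Definition _ k : isFinite (letter k) :=
  CanIsFinite (@letter_codeK k).

Definition Omega (k n : nat) (r : 'I_k.-1 -> nat) : finType :=
  {W : n.-tuple (letter k) | [forall i, count_mem (la i) W == r i]}.

Definition word_of (k n : nat) (r : 'I_k.-1 -> nat) (W : Omega n r) :
  seq (letter k) := val W.

(* [q0inf], [q0 i], [qinf i] and [q i j] are q_{0 infty}, q_{0i}, q_{i infty}
   and q_{ij}; only the values [q i j] with j < i are ever used. *)
Record pasep_params (K : Type) (k : nat) := PasepParams {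
  alpha : K;
  beta : K;
  q0inf : K;
  q0 : 'I_k.-1 -> K;
  qinf : 'I_k.-1 -> K;
  q : 'I_k.-1 -> 'I_k.-1 -> K
}.

Section Chain.
Variables (K : numFieldType) (k : nat) (p : pasep_params K k).

(* Rate of X x y Y -> X y x Y. *)
Definition swap_rate (x y : letter k) : K :=
  match x, y with
  | ld, le => 1
  | le, ld => q0inf p
  | ld, la _ => 1
  | la i, ld => q0 p i
  | la _, le => 1
  | le, la i => qinf p i
  | la i, la j => if (j < i)%N then 1 else if (i < j)%N then q p j i else 0
  | _, _ => 0
  end.

Definition bulk_rate (U V : seq (letter k)) : K :=
  \sum_(0 <= m < size U)
    match drop m U with
    | x :: y :: Y => if V == take m U ++ y :: x :: Y then swap_rate x y else 0
    | _ => 0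
    end.

Definition left_rate (U V : seq (letter k)) : K :=
  match U with
  | le :: X => if V == ld :: X then alpha p else 0
  | _ => 0
  end.

(* The last letter of U is the head of [rev U]. *)
Definition right_rate (U V : seq (letter k)) : K :=
  match rev U with
  | ld :: X => if V == rcons (rev X) le then beta p else 0
  | _ => 0
  end.

Definition rate (U V : seq (letter k)) : K :=
  bulk_rate U V + left_rate U V + right_rate U V.

Variables (n : nat) (r : 'I_k.-1 -> nat).

Definition exit_prob (U : Omega n r) : K :=
  \sum_(V | V != U) rate (word_of U) (word_of V) / n.+1%:R.

Definition trans_prob (U V : Omega n r) : K :=
  if V == U then 1 - exit_prob U
  else rate (word_of U) (word_of V) / n.+1%:R.

Definition stationary (pi : {ffun Omega n r -> K}) : Prop :=
  [/\ forall U, 0 <= pi U,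
      \sum_U pi U = 1
    & forall V, \sum_U pi U * trans_prob U V = pi V].

End Chain.

Section Ansatz.
Variables (K : numFieldType) (k : nat).
Variables (w : rowvec K) (v : colvec K).
Variables (D : mat K inf inf) (A : 'I_k.-1 -> mat K inf inf) (E : mat K inf inf).

Definition letter_mat (x : letter k) : mat K inf inf :=
  match x with ld => D | la i => A i | le => E end.

(* All bracketed products of consecutive factors of <w| M_{x1} ... M_{xl} |v>. *)
Inductive occurring_product : forall s t : dim, mat K s t -> Prop :=
| op_row : @occurring_product one inf w
| op_col : @occurring_product inf one v
| op_letter x : @occurring_product inf inf (letter_mat x)
| op_mul s t (X : mat K s inf) (Y : mat K inf t) :
    occurring_product X -> occurring_product Y ->
    occurring_product (mulm X Y).

Definition products_well_defined : Prop :=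
  forall s t (X : mat K s inf) (Y : mat K inf t),
    occurring_product X -> occurring_product Y -> mulm_defined X Y.

Definition products_associative : Prop :=
  forall s t (X : mat K s inf) (Y : mat K inf inf) (Z : mat K inf t),
    occurring_product X -> occurring_product Y -> occurring_product Z ->
    mulm (mulm X Y) Z = mulm X (mulm Y Z).

Definition word_value (s : seq (letter k)) : K :=
  scalar_of (mulm (foldl (fun (x : rowvec K) l => mulm x (letter_mat l)) w s) v).

(* A_{k-1}^{r_{k-1}} ... A_1^{r_1} *)
Definition sorted_word (r : 'I_k.-1 -> nat) : seq (letter k) :=
  flatten [seq nseq (r i) (la i) | i <- rev (enum 'I_k.-1)].

Definition ansatz_relations (p : pasep_params K k) : Prop :=
  [/\ forall a b, mulm D E a b - q0inf p * mulm E D a b = D a b + E a b,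
      forall i a b, mulm D (A i) a b - q0 p i * mulm (A i) D a b = A i a b,
      forall i a b, mulm (A i) E a b - qinf p i * mulm E (A i) a b = A i a b
    & forall i j : 'I_k.-1, (j < i)%N ->
        forall a b, mulm (A i) (A j) a b - q p i j * mulm (A j) (A i) a b = 0].

Definition boundary_relations (p : pasep_params K k) : Prop :=
  (forall b, mulm w E tt b = (alpha p)^-1 * w tt b) /\
  (forall a, mulm D v a tt = (beta p)^-1 * v a tt).

(* Matrices whose entries are polynomials in y_1, ..., y_{k-1}, given by the
   family of their coefficients: [P m] is the matrix coefficient of y^m.
   Their product is the Cauchy product, as in [mpoly.mcoeffM]. *)
Definition polymat (s t : dim) : Type := mpoly.multinom k.-1 -> mat K s t.

Definition polymat_const s t (X : mat K s t) : polymat s t :=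
  fun m a b => if m == mpoly.mnm0 then X a b else 0.

Definition polymat_var s t (i : 'I_k.-1) (X : mat K s t) : polymat s t :=
  fun m a b => if m == mpoly.mnm1 i then X a b else 0.

Definition polymat_mul s t (P : polymat s inf) (Q : polymat inf t) :
    polymat s t :=
  fun m a b =>
    \sum_(c : mpoly.bmultinom k.-1 (mpoly.mdeg m).+1 *
              mpoly.bmultinom k.-1 (mpoly.mdeg m).+1
          | m == mpoly.mnm_add (mpoly.bmnm c.1) (mpoly.bmnm c.2))
      mulm (P (mpoly.bmnm c.1)) (Q (mpoly.bmnm c.2)) a b.

(* D + y_1 A_1 + ... + y_{k-1} A_{k-1} + E *)
Definition generating_mat : polymat inf inf :=
  fun m a b => polymat_const D m a b
    + \sum_(i < k.-1) polymat_var i (A i) m a b + polymat_const E m a b.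

(* <w| (D + y_1 A_1 + ... + y_{k-1} A_{k-1} + E)^n |v> *)
Definition generating_poly (n : nat) : polymat one one :=
  polymat_mul
    (iter n (fun P : polymat one inf => polymat_mul P generating_mat)
       (polymat_const w))
    (polymat_const v).

Definition Zcoef (n : nat) (r : 'I_k.-1 -> nat) : K :=
  scalar_of (generating_poly n (mpoly.Multinom [tuple r i | i < k.-1]))
    / word_value (sorted_word r).

End Ansatz.

(* Main.v *)
Require Import Defs.
From mathcomp Require Import all_boot all_order all_algebra.
From mathcomp Require Import all_classical topology normedtype sequences.
From mathcomp Require Import(canonicals, coercions) mpoly.
From mathcomp Require Import ring zify.

Set Implicit Arguments.
Unset Strict Implicit.
Unset Printing Implicit Defensive.

Import Order.TTheory GRing.Theory Num.Theory.
Import numFieldNormedType.Exports.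
Local Open Scope ring_scope.

(** The weights [f W = <w| M_(W_1) ... M_(W_n) |v>] solve the balance equations
    of the chain, and the chain has so few invariant vectors that their
    normalization must be its stationary distribution.

    Balance.  Give the letters d, a_i, e the charges -1, 0, 1.  The quadratic
    relations of the ansatz all take the form
      [rate(y x -> x y) M_y M_x - rate(x y -> y x) M_x M_y
         = charge x M_y - charge y M_x],
    so the net probability flux into a word [V] across its m-th bond equals
    [g m - g m.+1], where [g m] is the charge of the letter at position [m]
    times the weight of [V] with that letter deleted.  The bonds telescope to
    [g 0 - g (n - 1)], and the two boundary relations say that the flux through
    the left end is [- g 0] and the flux through the right end is [g (n - 1)].
    This is [rate_balance].

    Uniqueness and positivity.  The weights are a priori arbitrary scalars,
    possibly complex, so their positivity has to come from the chain.
    If [mu] is invariant under a stochastic matrix then so is [|mu|], because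
    the triangle inequality [|mu| <= |mu| P] becomes an equality after summing
    over the states.  Moving every letter in the direction favoured by the
    rates of value 1, and turning every d that reaches the right end into e,
    leads from any word to the single word e...e a_1...a_1 ... a_(k-1)...a_(k-1),
    called [s] below.  Hence [s] is charged by every nonzero nonnegative
    invariant vector, any invariant vector vanishing at [s] is zero, and the
    invariant vectors form a line.  Comparing [mu] with [|mu|] on that line
    shows that an invariant vector of sum 1 is nonnegative.  This is
    [invariant_unique] and [invariant_ge0].

    Normalization.  Expanding the n-th power of the generating matrix gives one
    product of letter matrices per word, graded by the number of occurrences of
    each a_i; so the coefficient defining Z is the sum of the weights of the
    states, up to the common denominator.  This is [generating_poly_coef]. *)

(** * Invariant vectors of a stochastic matrix *)

Section Stochastic.
Variables (K : numFieldType) (T : finType) (P : T -> T -> K).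
Hypothesis P_ge0 : forall U V, 0 <= P U V.
Hypothesis P_sum1 : forall U, \sum_V P U V = 1.

Definition invariant (mu : T -> K) := forall V, \sum_U mu U * P U V = mu V.

(** The triangle inequality gives [|mu V| <= (|mu| P) V] for every [V], and both
    sides have the same sum over [V] since the rows of [P] sum to 1. *)
Lemma invariant_norm mu : invariant mu -> invariant (fun U => `|mu U|).
Proof.
move=> mu_inv V.
have le_mu V' : `|mu V'| <= \sum_U `|mu U| * P U V'.
  rewrite -{1}mu_inv; apply: le_trans (ler_norm_sum _ _ _) _.
  by apply: ler_sum => U _; rewrite normrM (ger0_norm (P_ge0 _ _)).
apply/eqP; rewrite -subr_eq0; apply/eqP.
apply: (psumr_eq0P (P := predT) (F := fun V => \sum_U `|mu U| * P U V - `|mu V|)) => //.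
  by move=> V' _; rewrite subr_ge0.
rewrite sumrB exchange_big /= (eq_bigr (fun U => `|mu U|)) ?subrr // => U _.
by rewrite -mulr_sumr P_sum1 mulr1.
Qed.

Lemma invariant_comb (a b : K) mu nu : invariant mu -> invariant nu ->
  invariant (fun U => a * mu U - b * nu U).
Proof.
move=> mu_inv nu_inv V; rewrite -mu_inv -nu_inv !mulr_sumr -sumrB.
by apply: eq_bigr => U _; rewrite mulrBl !mulrA.
Qed.

(* [s] is reachable from every state: [phi] strictly decreases along suitable
   transitions of positive probability, until [s] is attained. *)
Variables (phi : T -> nat) (s : T).
Hypothesis descent : forall U, U != s -> exists2 V, 0 < P U V & (phi V < phi U)%N.

(** A nonnegative invariant vector that is positive at [U] is positive at every
    state that [U] can jump to; follow the descending path from [U] to [s]. *)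
Lemma invariant_eq0 mu : invariant mu -> mu s = 0 -> forall U, mu U = 0.
Proof.
move=> /invariant_norm mu_inv mus0 U.
have [n] := ubnP (phi U); elim: n U => // n IHn U; rewrite ltnS => phiU.
have [->//|/descent[V PUV phiV]] := eqVneq U s.
have /IHn muV0: (phi V < n)%N by apply: leq_trans phiV phiU.
have: `|mu U| * P U V = 0.
  apply: (psumr_eq0P (P := predT) (F := fun U => `|mu U| * P U V)) => //.
    by move=> U' _; rewrite mulr_ge0.
  by rewrite mu_inv muV0 normr0.
by move/eqP; rewrite mulf_eq0 (gt_eqF PUV) orbF normr_eq0 => /eqP.
Qed.

(** The combination [nu s * mu - mu s * nu] is invariant and vanishes at [s]. *)
Lemma invariant_proportional mu nu : invariant mu -> invariant nu ->
  forall U, nu s * mu U = mu s * nu U.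
Proof.
move=> mu_inv nu_inv U; apply/eqP; rewrite -subr_eq0; apply/eqP.
apply: (invariant_eq0 (invariant_comb (nu s) (mu s) mu_inv nu_inv)).
by rewrite mulrC subrr.
Qed.

Lemma invariant_unique mu nu : invariant mu -> invariant nu ->
  \sum_U mu U = 1 -> \sum_U nu U = 1 -> mu =1 nu.
Proof.
move=> mu_inv nu_inv mu1 nu1.
have mus0 : mu s != 0.
  apply/eqP => /(invariant_eq0 mu_inv) mu0.
  by move: mu1; rewrite big1 => [/esym/eqP|//]; rewrite oner_eq0.
have eq_s : nu s = mu s.
  rewrite -[LHS]mulr1 -[RHS]mulr1 -{1}mu1 -nu1 !mulr_sumr.
  by apply: eq_bigr => U _; apply: invariant_proportional.
move=> U; apply: (mulfI mus0).
by rewrite -{1}eq_s; apply: invariant_proportional.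
Qed.

(** By uniqueness [mu] coincides with the normalization of [|mu|]. *)
Lemma invariant_ge0 mu : invariant mu -> \sum_U mu U = 1 -> forall U, 0 <= mu U.
Proof.
move=> mu_inv mu1 U; have norm_inv := invariant_norm mu_inv.
pose S := \sum_U `|mu U|.
have S_gt0 : 0 < S.
  by apply: lt_le_trans (ler_norm_sum _ _ _); rewrite mu1 normr1.
have : invariant (fun U => S^-1 * `|mu U| - 0 * mu U) by apply: invariant_comb.
move/(@invariant_unique mu _ mu_inv)->.
- by rewrite mul0r subr0 mulr_ge0 // invr_ge0 ltW.
- by [].
rewrite (eq_bigr (fun U => S^-1 * `|mu U|)); last by move=> V _; rewrite mul0r subr0.
by rewrite -mulr_sumr mulVf // gt_eqF.
Qed.

End Stochastic.

(** * The transitions of the chain as involutions on words *)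

Section Moves.
Variable k : nat.
Implicit Types (U V X Y : seq (letter k)) (x y : letter k) (T : seq (letter k) -> seq (letter k)).

(** Every transition exchanges two words related by an involution that fixes the
    numbers of letters a_i; this makes the flux into a word a single term per
    involution, as in [move_balance]. *)
Record is_move T : Prop := IsMove {
  move_invol : involutive T;
  move_size : forall U, size (T U) = size U;
  move_count : forall i U, count_mem (la i) (T U) = count_mem (la i) U
}.

Definition swap_at m U :=
  if drop m U is x :: y :: Y then take m U ++ y :: x :: Y else U.

Definition flip_first U :=
  match U with ld :: X => le :: X | le :: X => ld :: X | _ => U end.

Definition flip_last U := rev (flip_first (rev U)).

Lemma swap_at_cat X x y Y : swap_at (size X) (X ++ x :: y :: Y) = X ++ y :: x :: Y.
Proof. by rewrite /swap_at drop_size_cat // take_size_cat. Qed.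

Lemma swap_atP m U :
  (exists X x y Y, [/\ U = X ++ x :: y :: Y, size X = m & (m.+1 < size U)%N]) \/
  ((size U <= m.+1)%N /\ swap_at m U = U).
Proof.
case dU: (drop m U) => [|x [|y Y]].
- right; rewrite /swap_at dU; split=> //.
  by have := size_drop m U; rewrite dU => /esym/eqP; rewrite subn_eq0 => /leqW.
- right; rewrite /swap_at dU; split=> //.
  by have := size_drop m U; rewrite dU /= -subn_eq0 subnS => <-.
left; exists (take m U), x, y, Y.
have sU : (m.+1 < size U)%N.
  by have := size_drop m U; rewrite dU /= -subn_gt0 subnS => <-.
by rewrite -dU cat_take_drop size_takel // ltnW // ltnW.
Qed.

Lemma swap_at_move m : is_move (swap_at m).
Proof.
split=> [U|U|i U]; have [[X [x [y [Y [-> <- _]]]]]|[_ fixU]] := swap_atP m U.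
- by rewrite !swap_at_cat.
- by rewrite !fixU.
- by rewrite swap_at_cat !size_cat.
- by rewrite fixU.
- by rewrite swap_at_cat !count_cat /=; congr (_ + _)%N; rewrite addnCA.
- by rewrite fixU.
Qed.

Lemma flip_first_move : is_move flip_first.
Proof. by split=> [[|[|i|] U]|[|[|i|] U]|j [|[|i|] U]]. Qed.

Lemma flip_last_move : is_move flip_last.
Proof.
have [flipK flip_size flip_count] := flip_first_move.
split=> [U|U|i U]; rewrite /flip_last.
- by rewrite revK flipK revK.
- by rewrite size_rev flip_size size_rev.
- by rewrite count_rev flip_count count_rev.
Qed.

Lemma flip_last_rcons_d X : flip_last (rcons X ld) = rcons X le.
Proof. by rewrite /flip_last rev_rcons /= rev_cons revK. Qed.

Lemma flip_last_rcons_e X : flip_last (rcons X le) = rcons X ld.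
Proof. by rewrite /flip_last rev_rcons /= rev_cons revK. Qed.

Variables (K : numFieldType) (p : pasep_params K k).

Definition swap_rate_at m U : K :=
  if drop m U is x :: y :: _ then swap_rate p x y else 0.

Definition first_rate U : K := if U is le :: _ then alpha p else 0.

Definition last_rate U : K := if rev U is ld :: _ then beta p else 0.

Lemma swap_rate_at_cat X x y Y :
  swap_rate_at (size X) (X ++ x :: y :: Y) = swap_rate p x y.
Proof. by rewrite /swap_rate_at drop_size_cat. Qed.

Lemma bulk_rateE U V : bulk_rate p U V =
  \sum_(0 <= m < size U) if V == swap_at m U then swap_rate_at m U else 0.
Proof.
apply: eq_bigr => m _; rewrite /swap_at /swap_rate_at.
by case: (drop m U) => [|x [|y Y]] //; case: ifP.
Qed.

Lemma left_rateE U V :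
  left_rate p U V = if V == flip_first U then first_rate U else 0.
Proof. by case: U => [|[|i|] U] //=; case: ifP. Qed.

Lemma right_rateE U V :
  right_rate p U V = if V == flip_last U then last_rate U else 0.
Proof.
rewrite /right_rate /flip_last /last_rate; case: (rev U) => [|[|i|] X] /=.
- by case: ifP.
- by rewrite rev_cons.
- by case: ifP.
- by case: ifP.
Qed.

Section Omega.
Variables (n : nat) (r : 'I_k.-1 -> nat).
Implicit Types (Q R : Omega n r).

Lemma size_word Q : size (word_of Q) = n.
Proof. exact: size_tuple. Qed.

Lemma count_word Q i : count_mem (la i) (word_of Q) = r i.
Proof. exact: eqP (forallP (valP Q) i). Qed.

Lemma word_inj : injective (@word_of k n r).
Proof. by move=> Q R /val_inj/val_inj. Qed.

Lemma Omega_move T Q : is_move T -> {R : Omega n r | word_of R = T (word_of Q)}.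
Proof.
move=> mvT; have sT : size (T (word_of Q)) == n.
  by rewrite (move_size mvT) size_word.
have cT : [forall i, count_mem (la i) (Tuple sT) == r i].
  by apply/forallP => i; rewrite /= (move_count mvT) count_word.
by exists (exist _ (Tuple sT) cT).
Qed.

Lemma sum_move T (F : seq (letter k) -> K) R : is_move T ->
  \sum_(Q : Omega n r) (if word_of R == T (word_of Q) then F (word_of Q) else 0)
  = F (T (word_of R)).
Proof.
move=> mvT; have [R' R'E] := Omega_move R mvT.
rewrite -R'E -big_mkcond (big_pred1 R') // => Q /=.
rewrite -(inj_eq word_inj) R'E [RHS]eq_sym.
by rewrite -(inv_eq (move_invol mvT)).
Qed.

(** The net flux into the state [R] along one involution comes from the single
    state [T R]. *)
Lemma move_balance T (rho f : seq (letter k) -> K) R : is_move T ->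
  \sum_(Q : Omega n r) f (word_of Q) * (if word_of R == T (word_of Q) then rho (word_of Q) else 0)
  - f (word_of R) *
    \sum_(Q : Omega n r) (if word_of Q == T (word_of R) then rho (word_of R) else 0)
  = f (T (word_of R)) * rho (T (word_of R)) - f (word_of R) * rho (word_of R).
Proof.
move=> mvT; rewrite -(sum_move (fun U => f U * rho U) R mvT).
congr (_ - f _ * _).
  by apply: eq_bigr => Q _; case: ifP; rewrite // mulr0.
apply: etrans (sum_move (fun=> rho (word_of R)) R mvT).
by apply: eq_bigr => Q _; rewrite eq_sym (inv_eq (move_invol mvT)).
Qed.

(** * Balance of the probability fluxes *)

(** The scalar matrices [charge x] play the role of the auxiliary matrices in the
    usual cancellation mechanism of matrix product states. *)
Definition charge x : K := match x with ld => -1 | la _ => 0 | le => 1 end.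

(** What the matrix ansatz says about word weights, with the matrices forgotten.
    The four families of quadratic relations become one, uniform in the pair of
    letters. *)
Record bulk_boundary_relations (f : seq (letter k) -> K) : Prop := BulkBoundary {
  bulk_relation : forall X x y Y,
    f (X ++ y :: x :: Y) * swap_rate p y x - f (X ++ x :: y :: Y) * swap_rate p x y
    = charge x * f (X ++ y :: Y) - charge y * f (X ++ x :: Y);
  left_relation : forall X, f (le :: X) * alpha p = f X;
  right_relation : forall X, f (rcons X ld) * beta p = f X
}.

Variable f : seq (letter k) -> K.
Hypothesis f_rel : bulk_boundary_relations f.

(** The potential whose differences are the fluxes across the bonds of [V]. *)
Definition deletion_weight V m := charge (nth le V m) * f (take m V ++ drop m.+1 V).

Lemma deletion_weight_cat X x Y :
  deletion_weight (X ++ x :: Y) (size X) = charge x * f (X ++ Y).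
Proof.
rewrite /deletion_weight nth_cat ltnn subnn take_size_cat //=.
by rewrite -cat_rcons drop_size_cat // size_rcons.
Qed.

Lemma swap_flux V m : (m.+1 < size V)%N ->
  f (swap_at m V) * swap_rate_at m (swap_at m V) - f V * swap_rate_at m V
  = deletion_weight V m - deletion_weight V m.+1.
Proof.
have [[X [x [y [Y [-> <- _]]]]] _|[sV _]] := swap_atP m V; last by rewrite ltnNge sV.
rewrite swap_at_cat !swap_rate_at_cat (bulk_relation f_rel) deletion_weight_cat.
congr (_ - _).
by rewrite -[in RHS]cat_rcons -(size_rcons X x) deletion_weight_cat cat_rcons.
Qed.

Lemma bulk_flux V : (0 < size V)%N ->
  \sum_(0 <= m < size V)
    (f (swap_at m V) * swap_rate_at m (swap_at m V) - f V * swap_rate_at m V)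
  = deletion_weight V 0 - deletion_weight V (size V).-1.
Proof.
case sV: (size V) => [//|N] _.
(* The sum defining the rate also has a term for the last position, where there
   is no bond and [swap_at] is the identity. *)
rewrite big_nat_recr //=.
have [[X [x [y [Y [_ _]]]]]|[_ ->]] := swap_atP N V; first by rewrite sV ltnn.
rewrite subrr addr0 (eq_big_nat _ _ (F2 := fun m => - (deletion_weight V m.+1 - deletion_weight V m))).
  by rewrite sumrN telescope_sumr // opprB.
by move=> m /andP[_ mN]; rewrite swap_flux ?sV // opprB.
Qed.

Lemma left_flux V : (0 < size V)%N ->
  f (flip_first V) * first_rate (flip_first V) - f V * first_rate V
  = - deletion_weight V 0.
Proof.
case: V => [|x V] // _; rewrite /deletion_weight take0 drop1 /=.
by case: x => [|i|] /=; rewrite ?(left_relation f_rel); ring.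
Qed.

Lemma right_flux V : (0 < size V)%N ->
  f (flip_last V) * last_rate (flip_last V) - f V * last_rate V
  = deletion_weight V (size V).-1.
Proof.
elim/last_ind: V => [//|X x _] _.
have -> : deletion_weight (rcons X x) (size (rcons X x)).-1 = charge x * f X.
  by rewrite size_rcons -cats1 deletion_weight_cat cats0.
case: x => [|i|].
- by rewrite flip_last_rcons_d /last_rate !rev_rcons (right_relation f_rel) mulr0 mulN1r sub0r.
- by rewrite /last_rate /flip_last !rev_rcons /= rev_cons revK !rev_rcons !mulr0 mul0r subrr.
by rewrite flip_last_rcons_e /last_rate !rev_rcons (right_relation f_rel) mulr0 mul1r subr0.
Qed.

(** The bond fluxes telescope to a difference of two end terms, and these are
    cancelled by the fluxes through the two ends of the word. *)
Lemma rate_balance (n_gt0 : (0 < n)%N) R :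
  \sum_(Q : Omega n r) f (word_of Q) * rate p (word_of Q) (word_of R)
  = f (word_of R) * \sum_(Q : Omega n r) rate p (word_of R) (word_of Q).
Proof.
have V_gt0 : (0 < size (word_of R))%N by rewrite size_word.
apply/eqP; rewrite -subr_eq0; apply/eqP.
transitivity
  (\sum_(0 <= m < size (word_of R))
    (f (swap_at m (word_of R)) * swap_rate_at m (swap_at m (word_of R))
     - f (word_of R) * swap_rate_at m (word_of R))
   + (f (flip_first (word_of R)) * first_rate (flip_first (word_of R))
      - f (word_of R) * first_rate (word_of R))
   + (f (flip_last (word_of R)) * last_rate (flip_last (word_of R))
      - f (word_of R) * last_rate (word_of R))); last first.
  by rewrite bulk_flux // left_flux // right_flux //; ring.
rewrite size_word -(move_balance first_rate f R flip_first_move).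
rewrite -(move_balance last_rate f R flip_last_move).
under [in RHS]eq_bigr => m _ do rewrite -(move_balance (swap_rate_at m) f R (swap_at_move m)).
rewrite sumrB -mulr_sumr.
under eq_bigr => Q _ do rewrite /rate bulk_rateE left_rateE right_rateE size_word !mulrDr mulr_sumr.
under [X in _ - _ * X]eq_bigr => Q _ do rewrite /rate bulk_rateE left_rateE right_rateE size_word.
rewrite !big_split /= exchange_big /= [X in _ - _ * (X + _ + _)]exchange_big /=.
by ring.
Qed.

End Omega.

(** * A word reachable from every word *)

Section Irreducibility.
Hypotheses (alpha_gt0 : 0 < alpha p) (beta_gt0 : 0 < beta p).
Hypotheses (q0inf_ge0 : 0 <= q0inf p) (q0_ge0 : forall i, 0 <= q0 p i).
Hypotheses (qinf_ge0 : forall i, 0 <= qinf p i).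
Hypothesis q_ge0 : forall i j : 'I_k.-1, (j < i)%N -> 0 <= q p i j.

Lemma swap_rate_ge0 x y : 0 <= swap_rate p x y.
Proof.
case: x y => [|i|] [|j|] //=.
by case: ltnP => // _; case: ltnP => // ij; apply: q_ge0.
Qed.

Lemma swap_rate_at_ge0 m U : 0 <= swap_rate_at m U.
Proof. by rewrite /swap_rate_at; case: drop => [|x [|y Y]] //; apply: swap_rate_ge0. Qed.

Lemma bulk_rate_ge0 U V : 0 <= bulk_rate p U V.
Proof.
by rewrite bulk_rateE; apply: sumr_ge0 => m _; case: ifP => // _; apply: swap_rate_at_ge0.
Qed.

Lemma left_rate_ge0 U V : 0 <= left_rate p U V.
Proof. by rewrite /left_rate; case: U => [|[|i|] U] //; case: ifP => // _; apply: ltW. Qed.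

Lemma right_rate_ge0 U V : 0 <= right_rate p U V.
Proof. by rewrite /right_rate; case: rev => [|[|i|] X] //; case: ifP => // _; apply: ltW. Qed.

Lemma rate_ge0 U V : 0 <= rate p U V.
Proof. by rewrite !addr_ge0 ?bulk_rate_ge0 ?left_rate_ge0 ?right_rate_ge0. Qed.

(** The exchanges [x y -> y x] whose rate is the constant 1, whatever the
    parameters, are those with [rank y < rank x]. *)
Definition rank x : nat := match x with le => 0 | la i => i.+1 | ld => k end.

(** The letter at distance [j] from the right end contributes [j.+1] times its
    rank, so that exchanging [x y] into [y x] with [rank y < rank x] lowers the
    energy, and so does turning a final d into e. *)
Fixpoint energy U : nat :=
  if U is x :: X then (rank x * (size X).+1 + energy X)%N else 0%N.

Lemma energy_cat X Y Z : size Y = size Z -> (energy Y < energy Z)%N ->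
  (energy (X ++ Y) < energy (X ++ Z))%N.
Proof.
by move=> sYZ eYZ; elim: X => //= x X IHX; rewrite !size_cat sYZ ltn_add2l.
Qed.

Lemma rank_le (k_gt0 : (0 < k)%N) x : (rank x <= rank ld)%N.
Proof. by case: x => [|i|] //=; have := ltn_ord i; lia. Qed.

Lemma rank_inj : (0 < k)%N -> injective rank.
Proof.
move=> k_gt0 [|i|] [|j|] //=; try (have := ltn_ord i); try (have := ltn_ord j); try lia.
by move=> _ _ [/val_inj->].
Qed.

Lemma swap_rate_gt0 x y : (rank y < rank x)%N -> 0 < swap_rate p x y.
Proof.
case: x y => [|i|] [|j|] //=; rewrite ?ltnn //.
- by have := ltn_ord i; lia.
- by rewrite ltnS => ->.
Qed.

Definition rank_order x y := (rank x <= rank y)%N.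

Lemma not_sorted U : ~~ sorted rank_order U ->
  exists X x y Y, U = X ++ x :: y :: Y /\ (rank y < rank x)%N.
Proof.
elim: U => [|x [|y Y] IHU] //=; rewrite negb_and -ltnNge => /orP[xy|/IHU].
  by exists [::], x, y, Y.
by move=> [X [x' [y' [Y' [-> xy]]]]]; exists (x :: X), x', y', Y'.
Qed.

Variables (n : nat) (r : 'I_k.-1 -> nat).
Hypothesis k_gt0 : (0 < k)%N.
Implicit Types (Q R : Omega n r).

(** The words from which none of the energy-lowering transitions is possible. *)
Definition ground U := sorted rank_order U && (last le U != ld).

Lemma energy_descent Q : ~~ ground (word_of Q) ->
  exists2 R : Omega n r, 0 < rate p (word_of Q) (word_of R)
                  & (energy (word_of R) < energy (word_of Q))%N.
Proof.
rewrite negb_and => /orP[/not_sorted[X [x [y [Y [QE yx]]]]]|].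
  have [R RE] := Omega_move Q (swap_at_move (size X)); exists R; last first.
    by rewrite RE QE swap_at_cat; apply: energy_cat => //=; nia.
  rewrite /rate -addrA ltr_wpDr ?addr_ge0 ?left_rate_ge0 ?right_rate_ge0 //.
  rewrite bulk_rateE (bigD1_seq (size X)) ?iota_uniq //=; last first.
    by rewrite mem_index_iota QE size_cat /= -addSnnS leq_addr.
  rewrite ltr_wpDr ?RE ?eqxx ?QE ?swap_rate_at_cat ?swap_rate_gt0 //.
  by apply: sumr_ge0 => m _; case: ifP => // _; apply: swap_rate_at_ge0.
case/lastP QE: (word_of Q) => [|X x] //; rewrite last_rcons negbK => /eqP xd.
rewrite {}xd in QE *.
have [R RE] := Omega_move Q flip_last_move; exists R.
  rewrite /rate ltr_wpDl ?addr_ge0 ?bulk_rate_ge0 ?left_rate_ge0 //.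
  by rewrite right_rateE RE QE eqxx /last_rate rev_rcons.
rewrite RE QE flip_last_rcons_d -!cats1; apply: energy_cat => //=.
by rewrite !muln1 !addn0.
Qed.

(** The letter d has the largest rank, so in a sorted word any d forces the last
    letter to be d. *)
Lemma ground_no_d U : ground U -> ld \notin U.
Proof.
case/andP; elim: U => //= x U IHU xU lastU; rewrite inE negb_or.
apply/andP; split; last first.
  by case: U IHU xU lastU => // y U IHU /andP[_ yU] lastU; apply: IHU.
apply: contraNneq lastU => xd; rewrite -{}xd in xU *.
have : all (pred1 ld) U.
  have rank_trans : transitive rank_order by move=> ? ? ?; apply: leq_trans.
  apply: sub_all (order_path_min rank_trans xU) => y; rewrite /rank_order => dy /=.
  by apply/eqP/rank_inj => //; apply/eqP; rewrite eqn_leq dy rank_le.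
elim: U {IHU xU} => [|y U IHU] //=.
by case/andP=> /eqP-> /IHU.
Qed.

Lemma size_letters U : size U = (\sum_x count_mem x U)%N.
Proof.
elim: U => [|x U IHU] /=; first by rewrite big1.
rewrite big_split /= -IHU (bigD1 x) //= eqxx big1 // => y.
by rewrite eq_sym => /negPf->.
Qed.

(** A sorted word is determined by the multiplicities of its letters.  Those of
    the a_i are prescribed, d does not occur, and e fills the remaining places. *)
Lemma ground_unique Q R : ground (word_of Q) -> ground (word_of R) -> Q = R.
Proof.
move=> gQ gR; apply: word_inj.
have [/andP[sQ _] /andP[sR _]] := (gQ, gR).
have eq_count x : x != le -> count_mem x (word_of Q) = count_mem x (word_of R).
  case: x => // [|i] _; last by rewrite !count_word.
  by rewrite !(count_memPn _) ?ground_no_d.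
apply: (sorted_eq (leT := rank_order)) sQ sR _ => //.
- by move=> ? ? ?; apply: leq_trans.
- by move=> x y; rewrite /rank_order -eqn_leq => /eqP/rank_inj; apply.
apply/allP => x _ /=; apply/eqP; have [->|/eq_count//] := eqVneq x le.
have : size (word_of Q) = size (word_of R) by rewrite !size_word.
rewrite !size_letters (bigD1 le) //= [RHS](bigD1 le) //=.
by rewrite (eq_bigr _ eq_count) => /addIn.
Qed.

Hypothesis exit_le1 : forall Q, exit_prob p Q <= 1.

Lemma trans_prob_ge0 Q R : 0 <= trans_prob p Q R.
Proof.
rewrite /trans_prob; case: ifP => _; first by rewrite subr_ge0.
by rewrite divr_ge0 ?rate_ge0.
Qed.

Lemma trans_prob_sum1 Q : \sum_R trans_prob p Q R = 1.
Proof.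
rewrite (bigD1 Q) //= /trans_prob eqxx /exit_prob.
rewrite [X in _ + X](eq_bigr (fun R => rate p (word_of Q) (word_of R) / n.+1%:R)).
  by rewrite subrK.
by move=> R /negPf->.
Qed.

(** The state [Q0] only shows that the set of states is not empty; then lowering
    the energy as long as possible leads to the unique ground word. *)
Lemma trans_prob_descent (Q0 : Omega n r) :
  exists s : Omega n r, forall Q, Q != s ->
    exists2 R, 0 < trans_prob p Q R & (energy (word_of R) < energy (word_of Q))%N.
Proof.
have [s s_ground] : exists s : Omega n r, ground (word_of s).
  have [h] := ubnP (energy (word_of Q0)); elim: h Q0 => // h IH Q; rewrite ltnS => eQ.
  have [|/energy_descent[R _ eR]] := boolP (ground (word_of Q)); first by exists Q.
  exact: IH R (leq_trans eR eQ).
exists s => Q Qs; have [Q_ground|/energy_descent[R QR eR]] := boolP (ground (word_of Q)).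
  by rewrite (ground_unique Q_ground s_ground) eqxx in Qs.
exists R => //; rewrite /trans_prob; case: eqP => [RQ|_].
  by rewrite RQ ltnn in eR.
by rewrite divr_gt0.
Qed.

End Irreducibility.

Section Invariance.
Variables (n : nat) (r : 'I_k.-1 -> nat).
Variable f : seq (letter k) -> K.
Hypotheses (n_gt0 : (0 < n)%N) (f_rel : bulk_boundary_relations f).

(** In [rate_balance] the terms with [Q = R] agree on both sides and cancel, which
    leaves the balance between the flows into and out of [R]. *)
Lemma weight_invariant : invariant (trans_prob p (n := n) (r := r)) (fun Q => f (word_of Q)).
Proof.
move=> R.
have balance : \sum_(Q : Omega n r | Q != R) f (word_of Q) * rate p (word_of Q) (word_of R)
    = f (word_of R) * \sum_(Q : Omega n r | Q != R) rate p (word_of R) (word_of Q).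
  apply: (addrI (f (word_of R) * rate p (word_of R) (word_of R))).
  rewrite -mulrDr; have := rate_balance f_rel n_gt0 R.
  by rewrite (bigD1 R) //= => ->; rewrite (bigD1 R).
rewrite (bigD1 R) //= {1}/trans_prob eqxx mulrBr mulr1 /exit_prob.
rewrite -mulr_suml mulrA -balance mulr_suml.
rewrite [X in _ + X](eq_bigr (fun Q => f (word_of Q) * rate p (word_of Q) (word_of R) / n.+1%:R)).
  by rewrite subrK.
by move=> Q QR; rewrite /trans_prob eq_sym (negPf QR) mulrA.
Qed.

End Invariance.

End Moves.

(** * Linearity of infinite matrix products *)

Section MatrixProducts.
Variable K : numFieldType.

Lemma series_sum (I : Type) (r : seq I) (Q : pred I) (u : I -> nat -> K) :
  (forall i, cvgn (series (u i))) ->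
  cvgn (series (fun l => \sum_(i <- r | Q i) u i l)) /\
  limn (series (fun l => \sum_(i <- r | Q i) u i l))
    = \sum_(i <- r | Q i) limn (series (u i)).
Proof.
move=> u_cvg; elim: r => [|i r [IHcvg IHlim]].
  have -> : series (fun l => \sum_(i <- [::] | Q i) u i l) = (fun=> 0).
    by apply/funext => N; rewrite /series /= big1 // => l _; rewrite big_nil.
  by rewrite big_nil; split; [apply: is_cvg_cst | apply: lim_cst].
rewrite big_cons.
have -> : (fun l => \sum_(i <- i :: r | Q i) u i l)
    = (if Q i then u i + (fun l => \sum_(i <- r | Q i) u i l)
       else (fun l => \sum_(i <- r | Q i) u i l)).
  by apply/funext => l; rewrite big_cons; case: ifP.
case: ifP => // _; split; first exact: is_cvg_seriesD.
by rewrite lim_seriesD // IHlim.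
Qed.

Lemma mulm_sum s t (I J : finType) (P : pred I) (Q : pred J)
    (X : I -> mat K s inf) (Y : J -> mat K inf t) a b :
  (forall i j, mulm_defined (X i) (Y j)) ->
  mulm (fun a b => \sum_(i | P i) X i a b) (fun a b => \sum_(j | Q j) Y j a b) a b
  = \sum_(ij | P ij.1 && Q ij.2) mulm (X ij.1) (Y ij.2) a b.
Proof.
move=> XY_def; rewrite /mulm.
have [_ <-] := series_sum (index_enum (I * J)%type) (fun ij => P ij.1 && Q ij.2)
  (u := fun ij l => X ij.1 a l * Y ij.2 l b) (fun ij => XY_def ij.1 ij.2 a b).
congr (limn (series _)); apply/funext => l.
by rewrite big_distrlr /= pair_big.
Qed.

Lemma mulm_subl s t (c1 c2 : K) (X1 X2 : mat K s inf) (Y : mat K inf t) :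
  mulm_defined X1 Y -> mulm_defined X2 Y ->
  mulm (fun a b => c1 * X1 a b - c2 * X2 a b) Y
  = fun a b => c1 * mulm X1 Y a b - c2 * mulm X2 Y a b.
Proof.
move=> d1 d2; apply/funext => a; apply/funext => b.
have := lim_seriesB (is_cvg_seriesZ (k := c1) (d1 a b)) (is_cvg_seriesZ (k := c2) (d2 a b)).
rewrite !lim_seriesZ // /mulm => <-; congr (limn (series _)).
by apply/funext => l; rewrite mulrBl -!mulrA.
Qed.

Lemma mulm_subr s t (c1 c2 : K) (X : mat K s inf) (Y1 Y2 : mat K inf t) :
  mulm_defined X Y1 -> mulm_defined X Y2 ->
  mulm X (fun a b => c1 * Y1 a b - c2 * Y2 a b)
  = fun a b => c1 * mulm X Y1 a b - c2 * mulm X Y2 a b.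
Proof.
move=> d1 d2; apply/funext => a; apply/funext => b.
have := lim_seriesB (is_cvg_seriesZ (k := c1) (d1 a b)) (is_cvg_seriesZ (k := c2) (d2 a b)).
rewrite !lim_seriesZ // /mulm => <-; congr (limn (series _)).
by apply/funext => l; rewrite mulrBr !(mulrCA (X a l)).
Qed.

End MatrixProducts.

(** * Weights of words under the matrix ansatz *)

Section Ansatz.
Variables (K : numFieldType) (k : nat) (w : rowvec K) (v : colvec K).
Variables (D : mat K inf inf) (A : 'I_k.-1 -> mat K inf inf) (E : mat K inf inf).
Implicit Types (X Y : seq (letter k)) (x y : letter k).
Hypothesis hdef : products_well_defined w v D A E.
Hypothesis hassoc : products_associative w v D A E.

Local Notation M := (letter_mat D A E).
Local Notation occ := (occurring_product w v D A E).
Local Notation value := (word_value w v D A E).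

Definition row_word X : rowvec K := foldl (fun u x => mulm u (M x)) w X.
Definition col_word Y : colvec K := foldr (fun x c => mulm (M x) c) v Y.

Lemma row_word_occurs X : occ (row_word X).
Proof.
elim/last_ind: X => [|X x IHX]; first exact: op_row.
by rewrite /row_word foldl_rcons; apply: op_mul IHX (op_letter _ _ _ _ _ x).
Qed.

Lemma col_word_occurs Y : occ (col_word Y).
Proof.
elim: Y => [|y Y IHY]; first exact: op_col.
exact: op_mul (op_letter _ _ _ _ _ y) IHY.
Qed.

Lemma row_word_rcons X x : row_word (rcons X x) = mulm (row_word X) (M x).
Proof. by rewrite /row_word foldl_rcons. Qed.

Lemma letter_occurs x : occ (M x). Proof. exact: op_letter. Qed.

Hint Resolve row_word_occurs col_word_occurs letter_occurs : core.

(** Associativity allows a word to be cut anywhere, which is how a relation between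
    products of two matrices is applied inside a word. *)
Lemma value_cat X Y : value (X ++ Y) = scalar_of (mulm (row_word X) (col_word Y)).
Proof.
elim: Y X => [|y Y IHY] X; first by rewrite cats0.
by rewrite -cat_rcons IHY row_word_rcons hassoc.
Qed.

Lemma value_cat2 X x y Y :
  value (X ++ x :: y :: Y)
  = scalar_of (mulm (row_word X) (mulm (mulm (M x) (M y)) (col_word Y))).
Proof. by rewrite value_cat hassoc. Qed.

Variable p : pasep_params K k.
Hypotheses (alpha_neq0 : alpha p != 0) (beta_neq0 : beta p != 0).
Hypothesis hrel : ansatz_relations D A E p.
Hypothesis hbd : boundary_relations w v D E p.

(** For [x = y] both sides vanish, and exchanging [x] and [y] changes both signs,
    so that each of the four families of relations covers two cases. *)
Lemma letter_relation x y a b :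
  swap_rate p y x * mulm (M y) (M x) a b - swap_rate p x y * mulm (M x) (M y) a b
  = charge K x * M y a b - charge K y * M x a b.
Proof.
have [DE DA AE AA] := hrel.
case: x y => [|i|] [|j|] /=.
- by ring.
- by rewrite -DA; ring.
- have -> : D a b = mulm D E a b - q0inf p * mulm E D a b - E a b by rewrite DE addrK.
  by ring.
- by rewrite -DA; ring.
- have [ji|ij|/val_inj->] := ltngtP j i; last by ring.
    have -> : mulm (A i) (A j) a b = q p i j * mulm (A j) (A i) a b.
      by apply/eqP; rewrite -subr_eq0 AA.
    by ring.
  have -> : mulm (A j) (A i) a b = q p j i * mulm (A i) (A j) a b.
    by apply/eqP; rewrite -subr_eq0 AA.
  by ring.
- by rewrite -AE; ring.
- have -> : D a b = mulm D E a b - q0inf p * mulm E D a b - E a b by rewrite DE addrK.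
  by ring.
- by rewrite -AE; ring.
- by ring.
Qed.

Lemma value_bulk_relation X x y Y :
  value (X ++ y :: x :: Y) * swap_rate p y x
  - value (X ++ x :: y :: Y) * swap_rate p x y
  = charge K x * value (X ++ y :: Y) - charge K y * value (X ++ x :: Y).
Proof.
have rel : (fun a b => swap_rate p y x * mulm (M y) (M x) a b
                       - swap_rate p x y * mulm (M x) (M y) a b)
         = (fun a b => charge K x * M y a b - charge K y * M x a b).
  by apply/funext => a; apply/funext => b; apply: letter_relation.
have occ2 x' y' : occ (mulm (M x') (M y')) by apply: op_mul.
have := congr1 (fun N => mulm (row_word X) (mulm N (col_word Y)) tt tt) rel.
rewrite /= !mulm_subl; try by apply: hdef.
rewrite !mulm_subr; try by apply: hdef => //; apply: op_mul.
by rewrite !value_cat2 !value_cat /scalar_of /= ![_ * swap_rate _ _ _]mulrC.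
Qed.

Lemma value_left_relation X : value (le :: X) * alpha p = value X.
Proof.
have [wE _] := hbd.
have -> : value (le :: X) = scalar_of (mulm (row_word [:: le]) (col_word X)) by rewrite -value_cat.
(* The term with coefficient 0 only serves to reuse the linearity of products in
   the form of a difference. *)
have -> : row_word [:: le] = fun a b => (alpha p)^-1 * w a b - 0 * w a b.
  by apply/funext => -[]; apply/funext => b; rewrite /row_word /= wE mul0r subr0.
rewrite mulm_subl; try by apply: hdef => //; exact: op_row.
rewrite /scalar_of mul0r subr0 mulrAC mulVf // mul1r.
exact/esym/(value_cat [::]).
Qed.

Lemma value_right_relation X : value (rcons X ld) * beta p = value X.
Proof.
have [_ Dv] := hbd.
rewrite -cats1 value_cat.
have -> : col_word [:: ld] = fun a b => (beta p)^-1 * v a b - 0 * v a b.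
  by apply/funext => a; apply/funext => -[]; rewrite /col_word /= Dv mul0r subr0.
rewrite mulm_subr; try by apply: hdef => //; exact: op_col.
by rewrite /scalar_of mul0r subr0 mulrAC mulVf // mul1r.
Qed.

Lemma value_relations : bulk_boundary_relations p value.
Proof.
split; [exact: value_bulk_relation | exact: value_left_relation | exact: value_right_relation].
Qed.

(** * The generating function of the weights *)

Local Notation mnm := (mpoly.multinom k.-1).

(** A matrix of polynomials presented as a sum of monomials [X i * y ^ (g i)]
    over a finite index set.  The indices are kept, instead of collecting the
    coefficients, so that products become sums over pairs of indices. *)
Definition graded s t (I : finType) (g : I -> mnm) (X : I -> mat K s t) :
    polymat K k s t :=
  fun m a b => \sum_(i | g i == m) X i a b.

(** A pair of indices contributes to the Cauchy product through exactly one
    decomposition of its exponent, the one given by [g] and [h]. *)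
Lemma polymat_mul_graded s t (I J : finType) (g : I -> mnm) (h : J -> mnm)
    (X : I -> mat K s inf) (Y : J -> mat K inf t) :
  (forall i j, mulm_defined (X i) (Y j)) ->
  polymat_mul (graded g X) (graded h Y)
  = graded (fun ij : I * J => mpoly.mnm_add (g ij.1) (h ij.2))
           (fun ij => mulm (X ij.1) (Y ij.2)).
Proof.
move=> XY_def; apply/funext => m; apply/funext => a; apply/funext => b.
rewrite /polymat_mul /graded; under eq_bigr => c _ do rewrite mulm_sum //.
rewrite (exchange_big_dep (fun ij : I * J => mpoly.mnm_add (g ij.1) (h ij.2) == m)) /=.
  apply: eq_bigr => -[i j] /= /eqP ghm.
  have gi : (mpoly.mdeg (g i) < (mpoly.mdeg m).+1)%N by rewrite -ghm mpoly.mdegD ltnS leq_addr.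
  have hj : (mpoly.mdeg (h j) < (mpoly.mdeg m).+1)%N by rewrite -ghm mpoly.mdegD ltnS leq_addl.
  rewrite (big_pred1 (mpoly.BMultinom gi, mpoly.BMultinom hj)) // => -[c1 c2] /=.
  rewrite xpair_eqE -[c1 == _]val_eqE -[c2 == _]val_eqE /= [_ == g i]eq_sym [_ == h j]eq_sym.
  by apply: andb_idl => /andP[/eqP<- /eqP<-]; rewrite ghm.
by move=> c ij /eqP mE /andP[/eqP-> /eqP->]; rewrite -mE.
Qed.

Definition content X : mnm := mpoly.Multinom [tuple count_mem (la i) X | i < k.-1].

Lemma contentE X i : content X i = count_mem (la i) X.
Proof. by rewrite /content mpoly.mnmE. Qed.

Lemma sum_letters (V : nmodType) (F : letter k -> V) :
  \sum_x F x = F ld + \sum_i F (la i) + F le.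
Proof.
rewrite (bigD1 ld) //= (bigD1 le) //= -addrA [F le + _]addrC; congr (_ + (_ + _)).
rewrite (reindex_omap (fun i => la i) (fun x => if x is la i then Some i else None)) /=.
  by apply: eq_bigl => i; rewrite eqxx.
by case.
Qed.

Lemma generating_mat_graded :
  generating_mat D A E = graded (fun x => content [:: x]) M.
Proof.
have content_la i : content [:: la i] = mpoly.mnm1 i.
  by apply/mpoly.mnmP => j; rewrite contentE mpoly.mnm1E /= addn0.
have content0 x : (forall i, x != la i) -> content [:: x] = mpoly.mnm0.
  by move=> xa; apply/mpoly.mnmP => j; rewrite contentE mpoly.mnm0E /= (negPf (xa j)).
apply/funext => m; apply/funext => a; apply/funext => b.
rewrite /graded big_mkcond /= sum_letters !content0 //= /generating_mat /polymat_const.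
rewrite ![mpoly.mnm0 == m]eq_sym; congr (_ + _ + _); apply: eq_bigr => i _.
by rewrite /polymat_var content_la eq_sym.
Qed.

Lemma content_rcons X x : content (rcons X x) = mpoly.mnm_add (content X) (content [:: x]).
Proof.
by apply/mpoly.mnmP => i; rewrite mpoly.mnmDE !contentE -cats1 count_cat.
Qed.

(** Expanding the product by distributivity: each word of length [n] contributes
    one monomial, whose exponents count its letters a_i. *)
Lemma iter_graded n :
  iter n (fun P => polymat_mul P (generating_mat D A E)) (polymat_const w)
  = graded (fun X : n.-tuple (letter k) => content X) (fun X : n.-tuple (letter k) => row_word X).
Proof.
elim: n => [|n IHn].
  apply/funext => m; apply/funext => a; apply/funext => b.
  rewrite /graded big_mkcond /= (big_pred1 [tuple]) => [|X]; last by apply/esym/eqP; exact: tuple0.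
  have -> : content [::] = mpoly.mnm0 by apply/mpoly.mnmP => i; rewrite contentE.
  by rewrite /polymat_const eq_sym.
rewrite iterS IHn generating_mat_graded polymat_mul_graded; last by move=> X x; apply: hdef.
apply/funext => m; apply/funext => a; apply/funext => b; rewrite /graded.
rewrite (reindex (fun Xx : n.-tuple (letter k) * letter k => [tuple of rcons Xx.1 Xx.2])) /=.
  by apply: eq_big => [[X x]|[X x] _] /=; rewrite ?content_rcons ?row_word_rcons.
(* Appending a letter is a bijection from pairs onto words of length [n.+1]:
   it is injective, and the cardinalities agree. *)
apply: onW_bij; apply: inj_card_bij; last by rewrite card_prod !card_tuple expnSr.
by move=> [X x] [Y y] /(congr1 val) /= /rcons_inj[/val_inj-> ->].
Qed.

Lemma generating_poly_coef n (r : 'I_k.-1 -> nat) :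
  scalar_of (generating_poly w v D A E n (mpoly.Multinom [tuple r i | i < k.-1]))
  = \sum_(Q : Omega n r) value (word_of Q).
Proof.
have v_graded : @polymat_const K k _ _ v = graded (fun _ : unit => mpoly.mnm0) (fun=> v).
  apply/funext => m; apply/funext => a; apply/funext => b.
  rewrite /graded big_mkcond (big_pred1 tt) => [|[]//].
  by rewrite /polymat_const eq_sym.
rewrite /generating_poly iter_graded v_graded polymat_mul_graded; last first.
  by move=> X _; apply: hdef => //; apply: op_col.
rewrite /scalar_of /graded.
rewrite (reindex (fun X : n.-tuple (letter k) => (X, tt))) /=; last first.
  by exists fst => [X|[X []]].
have in_Omega X : (mpoly.mnm_add (content X) mpoly.mnm0 == mpoly.Multinom [tuple r i | i < k.-1])
    = [forall i, count_mem (la i) X == r i].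
  rewrite mpoly.addm0; apply/eqP/forallP => [XrE i|XrE].
    by rewrite -contentE XrE mpoly.mnmE.
  by apply/mpoly.mnmP => i; rewrite contentE mpoly.mnmE; apply/eqP.
rewrite (reindex_omap (fun Q : Omega n r => val Q) insub) /=.
  by apply: eq_bigl => Q; rewrite in_Omega (valP Q) valK eqxx.
by move=> X; rewrite in_Omega => Xr; rewrite insubT.
Qed.

End Ansatz.

Theorem theorem5p1 (K : numFieldType) (k n : nat) (r : 'I_k.-1 -> nat)
  (hk : (1 <= k)%N) (hn : (1 <= n)%N) (hr : (\sum_(i < k.-1) r i <= n)%N)
  (p : pasep_params K k)
  (halpha : 0 < alpha p) (hbeta : 0 < beta p)
  (hq0inf : 0 <= q0inf p <= 1)
  (hq0 : forall i, 0 <= q0 p i <= 1)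
  (hqinf : forall i, 0 <= qinf p i <= 1)
  (hq : forall i j : 'I_k.-1, (j < i)%N -> 0 <= q p i j <= 1)
  (hexit : forall U : Omega n r, exit_prob p U <= 1)
  (D : mat K inf inf) (A : 'I_k.-1 -> mat K inf inf) (E : mat K inf inf)
  (w : rowvec K) (v : colvec K)
  (hdef : products_well_defined w v D A E)
  (hassoc : products_associative w v D A E)
  (hwv : scalar_of (mulm w v) = 1)
  (hrel : ansatz_relations D A E p)
  (hbd : boundary_relations w v D E p)
  (hden : word_value w v D A E (sorted_word r) != 0)
  (hZ : Zcoef w v D A E n r != 0)
  (W : Omega n r) :
  exists pi : {ffun Omega n r -> K},
    unique (stationary p (n:=n) (r:=r)) pi /\
    pi W = (Zcoef w v D A E n r)^-1
           * (word_value w v D A E (word_of W)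
              / word_value w v D A E (sorted_word r)).
Proof.
pose S := \sum_(Q : Omega n r) word_value w v D A E (word_of Q).
have ZE : Zcoef w v D A E n r = S / word_value w v D A E (sorted_word r).
  by rewrite /Zcoef generating_poly_coef.
have S_neq0 : S != 0.
  by apply: contraNneq hZ => S0; rewrite ZE S0 mul0r.
have f_rel : bulk_boundary_relations p (word_value w v D A E).
  by apply: value_relations => //; rewrite gt_eqF.
pose mu (Q : Omega n r) := word_value w v D A E (word_of Q) / S.
have mu_inv : invariant (trans_prob p (n := n) (r := r)) mu.
  move=> R; rewrite /mu -(weight_invariant hn f_rel) mulr_suml.
  by apply: eq_bigr => Q _; rewrite mulrAC.
have mu1 : \sum_Q mu Q = 1 by rewrite -mulr_suml mulfV.
have q0inf_ge0 : 0 <= q0inf p by case/andP: hq0inf.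
have q0_ge0 i : 0 <= q0 p i by case/andP: (hq0 i).
have qinf_ge0 i : 0 <= qinf p i by case/andP: (hqinf i).
have q_ge0 (i j : 'I_k.-1) : (j < i)%N -> 0 <= q p i j by move=> /hq/andP[].
have P_ge0 (Q R : Omega n r) : 0 <= trans_prob p Q R by apply: trans_prob_ge0.
have [s P_descent] :=
  trans_prob_descent halpha hbeta q0inf_ge0 q0_ge0 qinf_ge0 q_ge0 hk W.
have P_sum1 := trans_prob_sum1 p (n := n) (r := r).
exists [ffun Q => mu Q]; split; last first.
  by rewrite ffunE /mu ZE invf_div; field; rewrite hden S_neq0.
split.
  split=> [Q||R]; first by rewrite ffunE (invariant_ge0 P_ge0 P_sum1 P_descent).
  - by under eq_bigr do rewrite ffunE.
  - by under eq_bigr do rewrite ffunE; rewrite ffunE mu_inv.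
move=> nu [_ nu1 nu_inv]; apply/ffunP => Q; rewrite ffunE.
by apply: (invariant_unique P_ge0 P_sum1 P_descent).
Qed.
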